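(* Let $n_1\le n_2\le n_3$ be positive even integers, $T=S(n_1,n_2,n_3)$, and $n=n_1+n_2+n_3+1$ its order. Then $\gamma_{\rm SMB}'(T)=\lceil\log_2 n\rceil$ if $T\in\mathcal{T}_0$, and $\gamma_{\rm SMB}'(T)=\lceil\log_2 n\rceil+1$ if $T\in\mathcal{T}_1$.
   Context: $S(n_1,\dots,n_\ell)$ is the subdivided star obtained from paths $P_{n_1},\dots,P_{n_\ell}$ and a new central vertex $x$ by making $x$ adjacent to one end of each path. The Maker-Breaker domination game on a finite simple graph $G$: Dominator and Staller alternately claim previously unclaimed vertices. Staller wins if she claims all vertices of the closed neighborhood $N_G[v]$ of some vertex $v$; otherwise Dominator wins. In the S-game Staller moves first. $\gamma_{\rm SMB}'(G)$ is the minimum number of moves Staller needs to win the S-game under optimal play (Staller minimizing, Dominator preventing or delaying), $\infty$ if she cannot win. For $T=S(n_1,n_2,n_3)$ with $n_1\le n_2\le n_3$ positive even integers and $n=n_1+n_2+n_3+1$: $T$ is reducible if $\lceil\log_2 n_3\rceil=\lceil\log_2 n\rceil$, and then its reduced graph is $T'=S(n_1,n_2,n_3-2^{\lceil\log_2 n\rceil-1})$ (again such a subdivided star with three even branches, branch lengths re-sorted); $T$ is non-reducible if $\lceil\log_2 n_i\rceil<\lceil\log_2 n\rceil$ for every $i\in\{1,2,3\}$. The classes $\mathcal{T}_0,\mathcal{T}_1$ are defined recursively: (i) if $T$ is non-reducible, then $T\in\mathcal{T}_1$ if $\lceil\log_2(n_1+n_2+1)\rceil=\lceil\log_2 n\rceil$,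 and $T\in\mathcal{T}_0$ if $\lceil\log_2(n_1+n_2+1)\rceil<\lceil\log_2 n\rceil$; (ii) if $T$ is reducible with reduced graph $T'$, then $T\in\mathcal{T}_1$ if $T'\in\mathcal{T}_1$ and $\lceil\log_2(n-2^{\lceil\log_2 n\rceil-2})\rceil=\lceil\log_2 n\rceil$, and otherwise $T\in\mathcal{T}_0$. *)

(* Defs.v *)
From HB Require Import structures.
From mathcomp Require Import all_boot.

Set Implicit Arguments.
Unset Strict Implicit.
Unset Printing Implicit Defensive.

Record sgraph := SGraph {
  vertex :> finType;
  adj : rel vertex;
  adj_sym : symmetric adj;
  adj_irr : irreflexive adj
}.

Definition closed_nbh (G : sgraph) (v : G) : {set G} :=
  [set u | (u == v) || adj v u].

(* The vertex [None] is the center and [Some (Tagged _ j)], with tag [i], is the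
   vertex at distance [j.+1] from the center on the [i]-th path. *)
Section SubdividedStar.
Variable ns : seq nat.

Definition star_vertex : finType :=
  option {i : 'I_(size ns) & 'I_(nth 0 ns i)}.

Definition star_adj (u v : star_vertex) : bool :=
  match u, v with
  | None, None => false
  | None, Some b => (tagged b : nat) == 0
  | Some a, None => (tagged a : nat) == 0
  | Some a, Some b =>
      (tag a == tag b) &&
      (((tagged a).+1 == tagged b :> nat) || ((tagged b).+1 == tagged a :> nat))
  end.

Lemma star_adj_sym : symmetric star_adj.
Proof. by move=> [a|] [b|] //=; rewrite eq_sym orbC. Qed.

Lemma star_adj_irr : irreflexive star_adj.
Proof.
by move=> [a|] //=; rewrite eqxx orbb; apply/negbTE; rewrite gtn_eqF.
Qed.

Definition subdivided_star : sgraph := SGraph star_adj_sym star_adj_irr.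

End SubdividedStar.

Section Game.
Variable G : sgraph.
Implicit Types S D : {set G}.

Definition staller_won S := [exists v : G, closed_nbh v \subset S].

(* In the position where Staller owns [S], Dominator owns [D] and Staller is to
   move, Staller can force a win making at most [k] further moves.  The clause
   [exists y, free y] is needed because the game ends, with a win for Dominator,
   when Staller takes the last vertex without winning. *)
Fixpoint staller_wins_within (k : nat) S D : bool :=
  staller_won S ||
  if k is k'.+1 then
    [exists x, (x \notin S :|: D) &&
      (staller_won (x |: S) ||
        let free := [pred y | y \notin (x |: S) :|: D] in
        [exists y, free y] &&
        [forall y, free y ==> staller_wins_within k' (x |: S) (y |: D)])]
  else false.

(* [None] stands for infinity.  Bounding the search by #|G| is harmless: see
   [gamma_SMB'P] and [gamma_SMB'_None]. *)
Definition gamma_SMB' : option nat :=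
  ohead [seq k <- iota 0 #|G|.+1 | staller_wins_within k set0 set0].

Lemma staller_wins_withinS k S D :
  staller_wins_within k S D -> staller_wins_within k.+1 S D.
Proof.
elim: k S D => [|k IHk] S D; first by rewrite /= orbF => ->.
rewrite /= => /orP[-> //|/existsP[x /andP[xfree /orP[xwin|]]]].
  by apply/orP; right; apply/existsP; exists x; rewrite xfree xwin.
case/andP=> exy /forallP ally; apply/orP; right; apply/existsP; exists x.
rewrite xfree exy /=; apply/orP; right; apply/forallP => y; apply/implyP => yfree.
by have /implyP/(_ yfree)/IHk := ally y.
Qed.

Lemma staller_wins_within_le k k' S D :
  k <= k' -> staller_wins_within k S D -> staller_wins_within k' S D.
Proof.
move=> /subnK <-; elim: (k' - k) => //= m IHm /IHm.
exact: staller_wins_withinS.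
Qed.

Lemma staller_wins_within_card k S D :
  staller_wins_within k S D -> staller_wins_within #|~: (S :|: D)| S D.
Proof.
elim: k S D => [|k IHk] S D.
  by rewrite [X in X -> _]/= orbF => Swon; apply: (@staller_wins_within_le 0);
     rewrite //= Swon.
case/orP=> [Swon|].
  by apply: (@staller_wins_within_le 0); rewrite //= Swon.
case/existsP=> x /andP[xfree xP].
have xC : x \in ~: (S :|: D) by rewrite inE.
rewrite (cardsD1 x) xC add1n /=; apply/orP; right; apply/existsP; exists x.
rewrite xfree /=; case/orP: xP => [-> //|/andP[exy /forallP ally]].
apply/orP; right; rewrite exy /=; apply/forallP => y; apply/implyP => yfree.
have /implyP/(_ yfree)/IHk := ally y; apply: staller_wins_within_le.
apply/subset_leq_card/subsetP => z; rewrite !inE !negb_or.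
by case/andP=> /andP[-> ->] /andP[_ ->].
Qed.

Lemma gamma_SMB'P k :
  gamma_SMB' = Some k <->
  staller_wins_within k set0 set0 /\
  (forall j, staller_wins_within j set0 set0 -> k <= j).
Proof.
have key : forall s, sorted ltn s ->
    ohead s = Some k <-> k \in s /\ (forall j, j \in s -> k <= j).
  case=> [|a s] /= srt; first by split=> // -[].
  have amin j : j \in a :: s -> a <= j.
    rewrite inE => /orP[/eqP -> //|js].
    by apply: ltnW; move: srt; rewrite (path_sortedE ltn_trans) =>
       /andP[/allP/(_ j js)].
  split=> [[<-]|[ks kmin]]; first by rewrite mem_head.
  by congr Some; apply/eqP; rewrite eqn_leq (amin k ks) kmin ?mem_head.
have cardle j : staller_wins_within j set0 set0 ->
    staller_wins_within #|G| set0 set0.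
  by move=> /staller_wins_within_card; rewrite setU0 setC0 cardsT.
rewrite /gamma_SMB'; apply: iff_trans (key _ _) _.
  by apply: sorted_filter (iota_ltn_sorted _ _); apply: ltn_trans.
split=> -[kP kmin].
  move: kP; rewrite mem_filter mem_iota /= ltnS => /andP[kW kle].
  split=> // j jW; case: (leqP j #|G|) => [jle|/ltnW jgt].
    by apply: kmin; rewrite mem_filter mem_iota jW ltnS.
  exact: leq_trans kle jgt.
split=> [|j]; last by rewrite mem_filter => /andP[/kmin].
by rewrite mem_filter mem_iota kP ltnS /= kmin // (cardle k).
Qed.

Lemma gamma_SMB'_None :
  gamma_SMB' = None <-> forall k, ~~ staller_wins_within k set0 set0.
Proof.
split=> [gN k|noW].
  apply/negP => kW; have exW : exists k, staller_wins_within k set0 set0.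
    by exists k.
  have [m mW mmin] := ex_minnP exW.
  by have /gamma_SMB'P := conj mW mmin; rewrite gN.
case Eg: gamma_SMB' => [k|] //; have /gamma_SMB'P[kW _] := Eg.
by have := noW k; rewrite kW.
Qed.

End Game.

(* Ceiling of the base 2 logarithm of a positive integer. *)
Notation clog2 := (up_log 2).

(* A subdivided star with three even branches is represented below by the sorted
   sequence [:: n1; n2; n3] of its branch lengths. *)
Definition even_tristar (n1 n2 n3 : nat) : Prop :=
  [/\ 0 < n1, n1 <= n2, n2 <= n3 & [/\ ~~ odd n1, ~~ odd n2 & ~~ odd n3]].

Definition star_order (n1 n2 n3 : nat) : nat := n1 + n2 + n3 + 1.

Definition reducible (n1 n2 n3 : nat) : Prop :=
  clog2 n3 = clog2 (star_order n1 n2 n3).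

Definition non_reducible (n1 n2 n3 : nat) : Prop :=
  [/\ clog2 n1 < clog2 (star_order n1 n2 n3),
      clog2 n2 < clog2 (star_order n1 n2 n3) &
      clog2 n3 < clog2 (star_order n1 n2 n3)].

Definition reduced (n1 n2 n3 : nat) : seq nat :=
  sort leq [:: n1; n2; n3 - 2 ^ (clog2 (star_order n1 n2 n3) - 1)].

Inductive class_T1 : seq nat -> Prop :=
| T1_non_reducible n1 n2 n3 :
    even_tristar n1 n2 n3 -> non_reducible n1 n2 n3 ->
    clog2 (n1 + n2 + 1) = clog2 (star_order n1 n2 n3) ->
    class_T1 [:: n1; n2; n3]
| T1_reducible n1 n2 n3 (n := star_order n1 n2 n3) :
    even_tristar n1 n2 n3 -> reducible n1 n2 n3 ->
    class_T1 (reduced n1 n2 n3) ->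
    clog2 (n - 2 ^ (clog2 n - 2)) = clog2 n ->
    class_T1 [:: n1; n2; n3].

Inductive class_T0 : seq nat -> Prop :=
| T0_non_reducible n1 n2 n3 :
    even_tristar n1 n2 n3 -> non_reducible n1 n2 n3 ->
    clog2 (n1 + n2 + 1) < clog2 (star_order n1 n2 n3) ->
    class_T0 [:: n1; n2; n3]
| T0_reducible n1 n2 n3 (n := star_order n1 n2 n3) :
    even_tristar n1 n2 n3 -> reducible n1 n2 n3 ->
    ~ (class_T1 (reduced n1 n2 n3) /\
       clog2 (n - 2 ^ (clog2 n - 2)) = clog2 n) ->
    class_T0 [:: n1; n2; n3].

(* Main.v *)
Require Import Defs.
From mathcomp Require Import all_boot.
From mathcomp Require Import zify.

Set Implicit Arguments.
Unset Strict Implicit.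
Unset Printing Implicit Defensive.

(* On a star with legs of even lengths 2a, 2b, 2c (possibly 0, so that odd
   paths are included), Staller wins within k+1 moves if and only if
   2^0, ..., 2^(k-1) can be distributed into three groups of sums at least
   a, b, c.  Indeed, if Staller claims a vertex of a leg that cuts off a path
   with an odd number 2t-1 of vertices, the rest is again such a star, with
   the leg shortened by 2t; Dominator can spoil only one of the two parts, and
   a single reply next to the claimed vertex lets him defend that part by a
   pairing strategy.  Against any other move Dominator has a reply after which
   a pairing strategy protects everything.
   The largest power has to go to the longest leg whenever that leg exceeds it,
   which is the reduction step defining the classes T_0 and T_1. *)

(** * Distributing powers of two *)

(* The powers [2 ^ 0], ..., [2 ^ k.-1] can be distributed into three groups of
   sums at least [a], [b] and [c]; truncated subtraction allows overshooting. *)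
Fixpoint pow2_cover (k a b c : nat) : bool :=
  if k is k'.+1 then
    [|| pow2_cover k' (a - 2 ^ k') b c, pow2_cover k' a (b - 2 ^ k') c
      | pow2_cover k' a b (c - 2 ^ k')]
  else [&& a == 0, b == 0 & c == 0].

Lemma pow2_coverSE k a b c : pow2_cover k.+1 a b c =
  [|| pow2_cover k (a - 2 ^ k) b c, pow2_cover k a (b - 2 ^ k) c
    | pow2_cover k a b (c - 2 ^ k)].
Proof. by []. Qed.

Lemma pow2_cover_mono k a b c a' b' c' :
  a' <= a -> b' <= b -> c' <= c -> pow2_cover k a b c -> pow2_cover k a' b' c'.
Proof.
elim: k a b c a' b' c' => [|k IHk] a b c a' b' c' lea leb lec /=; first lia.
by case/or3P=> kP; apply/or3P; [constructor 1|constructor 2|constructor 3];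
   move: kP; apply: IHk => //; apply: leq_sub2r.
Qed.

Lemma pow2_coverS k a b c : pow2_cover k a b c -> pow2_cover k.+1 a b c.
Proof.
move=> kP; apply/or3P; constructor 1.
by apply: pow2_cover_mono kP; rewrite ?leq_subr.
Qed.

Lemma pow2_cover_leq k k' a b c :
  k <= k' -> pow2_cover k a b c -> pow2_cover k' a b c.
Proof.
move=> /subnK <-; elim: (k' - k) => //= m IHm /IHm.
exact: pow2_coverS.
Qed.

Lemma pow2_cover12 k a b c : pow2_cover k a b c = pow2_cover k b a c.
Proof.
elim: k a b c => [|k IHk] a b c /=; first lia.
by rewrite (IHk (a - _)) (IHk a (b - _)) (IHk a b); do 3!case: pow2_cover.
Qed.

Lemma pow2_cover13 k a b c : pow2_cover k a b c = pow2_cover k c b a.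
Proof.
elim: k a b c => [|k IHk] a b c /=; first lia.
by rewrite (IHk (a - _)) (IHk a (b - _)) (IHk a b); do 3!case: pow2_cover.
Qed.

Lemma pow2_cover23 k a b c : pow2_cover k a b c = pow2_cover k a c b.
Proof. by rewrite pow2_cover12 pow2_cover13 pow2_cover12. Qed.

(** The powers in play sum to [2 ^ k - 1], which bounds what they can cover. *)
Lemma pow2_cover_sum k a b c : pow2_cover k a b c -> a + b + c < 2 ^ k.
Proof.
elim: k a b c => [|k IHk] a b c /=; first lia.
by rewrite expnS => /or3P[] /IHk; lia.
Qed.

(** Binary expansion: [b] receives exactly the powers in its expansion, and the others sum to
    [2 ^ k - 1 - b], which is at least [a]. *)
Lemma pow2_cover2 k a b : a + b < 2 ^ k -> pow2_cover k a b 0.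
Proof.
elim: k a b => [|k IHk] a b; first by rewrite expn0 /=; lia.
rewrite expnS => ab /=; case: (ltnP b (2 ^ k)) => bk.
  by rewrite IHk //; lia.
by rewrite (IHk a (b - _)) ?orbT //; lia.
Qed.

(** The extra power [2 ^ k] covers [c] alone, which leaves the case of two groups. *)
Lemma pow2_coverS_sum k a b c : a + b + c < 2 ^ k -> pow2_cover k.+1 a b c.
Proof.
move=> abc /=; have -> : c - 2 ^ k = 0 by lia.
by rewrite (@pow2_cover2 k a b) ?orbT //; lia.
Qed.

(** * Ceiling logarithms and the classes in terms of covers by powers of two *)

Lemma clog2_leq m k : (clog2 m <= k) = (m <= 2 ^ k).
Proof.
apply/idP/idP => [le|]; last exact: up_log_min.
by apply: leq_trans (up_logP m (isT : 1 < 2)) _; rewrite leq_exp2l.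
Qed.

Lemma clog2_eqS m k : (clog2 m == k.+1) = (2 ^ k < m <= 2 ^ k.+1).
Proof. by rewrite eqn_leq clog2_leq ltnNge clog2_leq -ltnNge andbC. Qed.

Lemma sort_leq3 a b c : a <= b ->
  exists x y z, [/\ sort leq [:: a; b; c] = [:: x; y; z], x <= y, y <= z &
    [\/ [/\ x = a, y = b & z = c], [/\ x = a, y = c & z = b]
      | [/\ x = c, y = a & z = b]]].
Proof.
move=> leab; rewrite /sort /=.
case: (leqP a b) leab => // leab _ /=; case: (leqP a c) => leac /=.
  case: (leqP b c) => lebc /=.
    by exists a, b, c; split=> //; constructor 1.
  by exists a, c, b; split=> //; [apply: ltnW|constructor 2].
by exists c, a, b; split=> //; [apply: ltnW|constructor 3].
Qed.

(** The order is twice the sum of the half lengths plus one, and at least 7. Writing its logarithm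
    as [K.+3] avoids truncated subtraction in exponents later on. *)
Lemma even_tristar_order n1 n2 n3 : even_tristar n1 n2 n3 ->
  exists K, [/\ clog2 (star_order n1 n2 n3) = K.+3,
    2 ^ K.+1 <= n1./2 + n2./2 + n3./2 & n1./2 + n2./2 + n3./2 < 2 ^ K.+2].
Proof.
move=> [p1 le12 le23 [e1 e2 e3]]; rewrite /star_order.
set n := n1 + n2 + n3 + 1.
have : ~~ (clog2 n <= 2) by rewrite clog2_leq /n; lia.
case E: (clog2 n) => [|[|[|K]]] // _; exists K; split=> //.
  all: move/eqP: E; rewrite clog2_eqS /n !expnS; lia.
Qed.

Lemma class_T1_inv n1 n2 n3 (n := star_order n1 n2 n3) :
  class_T1 [:: n1; n2; n3] ->
  non_reducible n1 n2 n3 /\ clog2 (n1 + n2 + 1) = clog2 n \/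
  [/\ reducible n1 n2 n3, class_T1 (reduced n1 n2 n3) &
      clog2 (n - 2 ^ (clog2 n - 2)) = clog2 n].
Proof. by move=> c1; inversion c1; [left|right]. Qed.

(** Reducible and non-reducible stars exclude each other, and in either case the two classes have
    complementary conditions. Hence a criterion for [class_T1] settles both. *)
Lemma class_T0_not_T1 n1 n2 n3 :
  class_T0 [:: n1; n2; n3] -> ~ class_T1 [:: n1; n2; n3].
Proof.
move=> c0 /class_T1_inv c1; inversion c0 as [? ? ? _ [_ _ NR] lt|? ? ? ? _ R no].
  by case: c1 => [[_ E]|[R _ _]]; [rewrite E ltnn in lt|rewrite R ltnn in NR].
by case: c1 => [[[_ _]]|[_ c1 E]]; [rewrite R ltnn|case: no].
Qed.

(** The recursion of the classes follows the fate of the largest power: on a reducible star it is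
    forced onto the longest leg, and the reduced star is what remains to be covered; on a
    non-reducible star the question becomes one about two legs. *)
Lemma class_T1P n1 n2 n3 : even_tristar n1 n2 n3 ->
  class_T1 [:: n1; n2; n3] <->
  ~~ pow2_cover (clog2 (star_order n1 n2 n3)).-1 n1./2 n2./2 n3./2.
Proof.
have [m] := ubnP (n1 + n2 + n3); elim: m n1 n2 n3 => // m IHm n1 n2 n3 nm T.
have [K [EK geK ltK]] := even_tristar_order T.
have [p1 le12 le23 [e1 e2 e3]] := T; rewrite EK -[K.+3.-1]/K.+2.
case: (leqP n3 (2 ^ K.+2)) => n3K.
  have NR : non_reducible n1 n2 n3.
    by split; rewrite EK ltnS clog2_leq //; [apply: leq_trans le12 _|];
       apply: leq_trans le23 _.
  (* The top power [2 ^ K.+1] covers the third leg alone. Wherever it goes, two legs remain entirely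
     for powers of sum [2 ^ K.+1 - 1], and the first two legs are the cheapest such pair. *)
  have -> : pow2_cover K.+2 n1./2 n2./2 n3./2 = (n1./2 + n2./2 < 2 ^ K.+1).
    apply/idP/idP => [|lt12]; rewrite pow2_coverSE.
      by case/or3P=> /pow2_cover_sum; rewrite !expnS in n3K *; lia.
    rewrite (_ : n3./2 - _ = 0); last by rewrite !expnS in n3K *; lia.
    by rewrite pow2_cover2 ?orbT.
  have E12 : (clog2 (n1 + n2 + 1) == K.+3) = ~~ (n1./2 + n2./2 < 2 ^ K.+1).
    by rewrite clog2_eqS !expnS in ltK *; lia.
  rewrite -E12; split=> [/class_T1_inv[[_ ->]|[R _ _]]|/eqP E].
  - by rewrite EK.
  - by case: NR => _ _; rewrite R ltnn.
  by apply: T1_non_reducible => //; rewrite EK.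
have R : reducible n1 n2 n3.
  rewrite /reducible EK; apply/eqP; rewrite clog2_eqS n3K /=.
  by rewrite !expnS in ltK *; lia.
have [x [y [z [Exyz lexy leyz perm]]]] := sort_leq3 (n3 - 2 ^ K.+2) le12.
have Er : reduced n1 n2 n3 = [:: x; y; z] by rewrite /reduced EK subn1.
have ev : ~~ odd (n3 - 2 ^ K.+2) by rewrite oddB ?(ltnW n3K) // oddX (negbTE e3).
have T' : even_tristar x y z by case: perm => -[? ? ?]; subst; split=> //; lia.
have sum : x + y + z = n1 + n2 + n3 - 2 ^ K.+2 by case: perm => -[? ? ?]; subst; lia.
have pos : 0 < 2 ^ K.+2 by rewrite expn_gt0.
have {}IHm := IHm x y z _ T'; have {}IHm := IHm ltac:(lia).
have cxyz k : pow2_cover k x./2 y./2 z./2 =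
    pow2_cover k n1./2 n2./2 (n3./2 - 2 ^ K.+1).
  have -> : n3./2 - 2 ^ K.+1 = (n3 - 2 ^ K.+2)./2 by rewrite !expnS; lia.
  case: perm => -[-> -> ->] //; first by rewrite pow2_cover23.
  by rewrite pow2_cover13 pow2_cover12 pow2_cover13 pow2_cover23.
(* Without the top power, the third leg alone would exceed the sum of all the others. *)
have cE : pow2_cover K.+2 n1./2 n2./2 n3./2 = pow2_cover K.+1 x./2 y./2 z./2.
  rewrite cxyz; apply/idP/idP => [|H]; rewrite pow2_coverSE; last by apply/or3P; constructor 3.
  by case/or3P=> // /pow2_cover_sum; rewrite !expnS in n3K *; lia.
(* The numerical condition on [n] says that reduction lowers the logarithm of the order by exactly
   one, so that the reduced star is tested with one power fewer. *)
have dE : (clog2 (star_order n1 n2 n3 - 2 ^ (K.+3 - 2)) == K.+3) =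
    (clog2 (star_order x y z) == K.+2).
  rewrite !clog2_eqS /star_order (_ : K.+3 - 2 = K.+1); last by lia.
  by rewrite !expnS in ltK geK n3K sum *; lia.
rewrite cE; split=> [/class_T1_inv[[[_ _]]|[_]]|nc].
- by rewrite R ltnn.
- by rewrite Er EK => /IHm IH /eqP; rewrite dE => /eqP E; rewrite E in IH.
have [K' [EK' geK' ltK']] := even_tristar_order T'.
(* A smaller logarithm would make the half lengths sum to so little that [pow2_coverS_sum] yields
   the cover excluded by [nc]. *)
have cl : clog2 (star_order x y z) = K.+2.
  apply/eqP; rewrite eqn_leq; apply/andP; split.
    by rewrite clog2_leq /star_order; rewrite !expnS in ltK n3K sum *; lia.
  rewrite ltnNge; apply/negP => le; move/negP: nc; apply.
  apply: (@pow2_cover_leq K'.+3); first by rewrite -EK'.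
  exact: pow2_coverS_sum.
apply: T1_reducible => //; first by rewrite Er; apply/IHm; rewrite cl.
by apply/eqP; rewrite EK dE cl.
Qed.

(** * Dominator's strategy *)

(** Through counts, disjointness and inclusion of lists become linear arithmetic for [lia]. *)
Lemma mem_count (T : eqType) (z : T) s : (z \in s) = (0 < count_mem z s).
Proof. by rewrite -has_count has_pred1. Qed.

(** Encodes a pairing strategy by a list, so that pairings of even lists merge by concatenation; the
    last element of an odd list stays unpaired. *)
Fixpoint pairs (T : Type) (s : seq T) : seq (T * T) :=
  if s is a :: b :: s' then (a, b) :: pairs s' else [::].

Lemma seq_ind2 (T : Type) (P : seq T -> Prop) :
  P [::] -> (forall a, P [:: a]) -> (forall a b s, P s -> P [:: a, b & s]) ->
  forall s, P s.
Proof.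
move=> P0 P1 P2 s; have [m] := ubnP (size s); elim: m s => // m IHm.
by case=> [|a [|b s]] //= sm; apply/P2/IHm; rewrite -ltnS ltnW.
Qed.

Section Pairs.
Variable T : eqType.
Implicit Types s t : seq T.

Lemma pairs_cat s t : ~~ odd (size s) -> pairs (s ++ t) = pairs s ++ pairs t.
Proof. by elim/seq_ind2: s => //= a b s IHs; rewrite negbK => /IHs ->. Qed.

Lemma mem_pairs s a b : (a, b) \in pairs s -> a \in s /\ b \in s.
Proof.
elim/seq_ind2: s => //= c d s IHs; rewrite !inE xpair_eqE.
by case/orP=> [/andP[-> ->]|/IHs[-> ->]]; rewrite ?orbT.
Qed.

Lemma pairs_neq s a b : uniq s -> (a, b) \in pairs s -> a != b.
Proof.
elim/seq_ind2: s => //= c d s IHs; rewrite !inE xpair_eqE negb_or.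
case/andP=> /andP[cd _] /andP[_ us] /orP[/andP[/eqP-> /eqP->] //|].
exact: IHs.
Qed.

Lemma pairs_disjoint s a b c d z : uniq s ->
  (a, b) \in pairs s -> (c, d) \in pairs s ->
  z \in [:: a; b] -> z \in [:: c; d] -> (a, b) = (c, d).
Proof.
elim/seq_ind2: s => //= e f s IHs; rewrite !inE !xpair_eqE negb_or.
case/and3P=> /andP[_ es] fs us.
have out u v : (u, v) \in pairs s ->
    [/\ (u == e) = false, (u == f) = false, (v == e) = false & (v == f) = false].
  move=> /mem_pairs[us' vs']; split; apply: contraTF (es) => /eqP E.
  - by rewrite -E us'.
  - by rewrite -E us' in fs.
  - by rewrite -E vs'.
  - by rewrite -E vs' in fs.
case/orP=> [/andP[/eqP-> /eqP->]|ab].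
  case/orP=> [/andP[/eqP-> /eqP->] //|cd].
  have [c1 c2 d1 d2] := out _ _ cd.
  by case/orP=> /eqP->; rewrite eq_sym ?c1 ?c2 eq_sym ?d1 ?d2.
case/orP=> [/andP[/eqP-> /eqP->]|cd]; last first.
  by move=> z1 z2; apply: IHs => //; rewrite !inE.
have [c1 c2 d1 d2] := out _ _ ab.
by case/orP=> /eqP->; rewrite ?c1 ?c2 ?d1 ?d2.
Qed.

End Pairs.

(** * Monotonicity, pairing strategies and the lower bound *)

Section Dominator.
Variable G : sgraph.
Implicit Types (S D : {set G}) (L p q r : seq G) (v x y : G).

Lemma closed_nbh_refl v : v \in closed_nbh v.
Proof. by rewrite inE eqxx. Qed.

Lemma adj_closed_nbh v u : adj v u -> u \in closed_nbh v.
Proof. by rewrite inE => ->; rewrite orbT. Qed.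

Lemma adj_closed_nbh_sym v u : adj v u -> v \in closed_nbh u.
Proof. by rewrite adj_sym; apply: adj_closed_nbh. Qed.

Lemma staller_won_wins k S D : staller_won S -> staller_wins_within k S D.
Proof. by case: k => [|k] /= ->. Qed.

(** Staller keeps her strategy for [D]. If Dominator takes a vertex of [D], she acts as if he had
    taken some free [y], supplied by the clause on free vertices. *)
Lemma staller_wins_within_sub k S D D' :
  D' \subset D -> staller_wins_within k S D -> staller_wins_within k S D'.
Proof.
elim: k S D D' => [|k IHk] S D D' sub //=.
case/orP=> [-> //|/existsP[x /andP[xf xP]]].
have mono y : y \notin (x |: S) :|: D -> y \notin (x |: S) :|: D'.
  by apply: contra; apply/subsetP/setUS.
apply/orP; right; apply/existsP; exists x.
rewrite (contra _ xf) /=; last by apply/subsetP/setUS.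
case/orP: xP => [-> //|/andP[/existsP[y yf] /forallP ally]].
apply/orP; right; apply/andP; split; first by apply/existsP; exists y; apply: mono.
apply/forallP => z; apply/implyP => zf.
case: (boolP (z \in D)) => zD.
  have /implyP/(_ yf) := ally y; apply: IHk.
  apply: (subset_trans _ (subsetUr _ _)).
  by rewrite subUset sub1set zD.
have zf' : z \notin (x |: S) :|: D by move: zf; rewrite !inE (negbTE zD) !negb_or andbT => /andP[].
by have /implyP/(_ zf') := ally z; apply: IHk; apply: setUS.
Qed.

(** Form of the recursion suited to Dominator: by monotonicity he may also pass, so no free vertex
    has to be exhibited for him. *)
Lemma staller_wins_withinS_inv k S D : staller_wins_within k.+1 S D ->
  staller_won S \/
  exists x, [/\ x \notin S, x \notin D, staller_wins_within k (x |: S) D &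
    forall y, y != x -> y \notin S -> y \notin D ->
      staller_wins_within k (x |: S) (y |: D)].
Proof.
case/orP=> [|/existsP[x /andP[]]]; first by left.
rewrite inE negb_or => /andP[xS xD] xP; right; exists x.
case/orP: xP => [won|/andP[/existsP[y yf] /forallP ally]].
  by split=> // [|y _ _ _]; apply: staller_won_wins.
split=> // [|z zx zS zD].
  have /implyP/(_ yf) := ally y; apply: staller_wins_within_sub.
  exact: subsetUr.
by have /implyP := ally z; apply; rewrite /= !inE !negb_or zx zS.
Qed.

(** Invariant of the pairing strategy. As [S] and [D] are not assumed disjoint, [d \notin S] is part
    of it. *)
Definition covered S D L v : Prop :=
  (exists d, [/\ d \in closed_nbh v, d \in D & d \notin S]) \/
  exists a b, [/\ (a, b) \in pairs L, a \in closed_nbh v, b \in closed_nbh v,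
                  a \notin S :|: D & b \notin S :|: D].

Lemma covered_not_won S D L v : covered S D L v ->
  exists2 w, w \in closed_nbh v & w \notin S.
Proof.
case=> [[d [dv _ dS]]|[a [b [_ av _ aS _]]]]; first by exists d.
by exists a => //; move: aS; rewrite inE negb_or => /andP[].
Qed.

Lemma not_staller_won S :
  (forall v, exists2 w, w \in closed_nbh v & w \notin S) -> ~~ staller_won S.
Proof.
move=> H; apply/existsP => -[v /subsetP sub]; have [w /sub wS] := H v.
by rewrite wS.
Qed.

(** Dominator takes the partner of [x] if [x] lies in a free pair, and passes ([D' = D])
    otherwise. *)
Lemma covered_reply S D L x : uniq L -> x \notin S -> x \notin D ->
  exists D', (D' = D \/ exists y, [/\ y != x, y \in L, y \notin S, y \notin D & D' = y |: D])
    /\ forall v, covered S D L v -> covered (x |: S) D' L v.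
Proof.
move=> uL xS xD.
have keepD D' v : D \subset D' ->
    (exists d, [/\ d \in closed_nbh v, d \in D & d \notin S]) ->
    covered (x |: S) D' L v.
  move=> /subsetP sub [d [dv dD dS]]; left; exists d; split=> //; first exact: sub.
  by rewrite !inE negb_or dS andbT; apply: contraNneq xD => <-.
pose P (ab : G * G) := [&& x \in [:: ab.1; ab.2], ab.1 \notin S :|: D & ab.2 \notin S :|: D].
have reply a b y : (a, b) \in pairs L -> [:: a; b] =i [:: x; y] -> y != x ->
    a \notin S :|: D -> b \notin S :|: D ->
  forall v, covered S D L v -> covered (x |: S) (y |: D) L v.
  move=> abL E yx aF bF v.
  have yF : y \notin S :|: D.
    have: y \in [:: a; b] by rewrite E !inE eqxx orbT.
    by rewrite !inE => /orP[/eqP->|/eqP->]; rewrite -in_setU.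
  case=> [|[c [d [cdL cv dv cF dF]]]]; first by apply: keepD; apply: subsetUr.
  (* If the pair serving [v] contains [y], then [y] now dominates [v]; otherwise the pair avoids [x]
     too, by disjointness of pairs, and stays free. *)
  case: (boolP (y \in [:: c; d])) => ycd.
    left; exists y; split; last 1 first.
    - by rewrite !inE negb_or yx /=; move: yF; rewrite inE negb_or => /andP[].
    - by have [/eqP->|/eqP->] : y == c \/ y == d by apply/orP; rewrite !inE in ycd.
    - by rewrite !inE eqxx.
  have xcd : x \notin [:: c; d].
    apply: contra ycd => xcd.
    have xab : x \in [:: a; b] by rewrite E !inE eqxx.
    by have [<- <-] := pairs_disjoint uL abL cdL xab xcd; rewrite E !inE eqxx orbT.
  right; exists c, d; split=> //; move: xcd ycd cF dF; rewrite !inE !negb_or.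
    by rewrite ![_ == c]eq_sym => /andP[-> _] /andP[-> _] /andP[-> ->].
  by rewrite ![_ == d]eq_sym => /andP[_ ->] /andP[_ ->] _ /andP[-> ->].
case: (boolP (has P (pairs L))) => [/hasP[[a b] abL /and3P[/= xab aF bF]]|noP].
  have ab := pairs_neq uL abL.
  have [y [E yx]] : exists y, [:: a; b] =i [:: x; y] /\ y != x.
    move: xab; rewrite !inE => /orP[] /eqP E; [exists b|exists a].
      by rewrite E eq_sym; split.
    by rewrite E; split=> // z; rewrite !inE orbC.
  exists (y |: D); split; last exact: reply abL E yx aF bF.
  right; exists y; have yab : y \in [:: a; b] by rewrite E !inE eqxx orbT.
  have [aL bL] := mem_pairs abL.
  move: aF bF yab; rewrite !inE !negb_or => /andP[aS aD] /andP[bS bD].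
  by case/orP=> /eqP Ey; rewrite Ey in yx *.
exists D; split=> [|v]; first by left.
case=> [|[c [d [cdL cv dv cF dF]]]]; first exact: keepD.
have := hasPn noP _ cdL; rewrite /P /= cF dF !andbT => xcd.
right; exists c, d; split=> //; move: xcd cF dF; rewrite !inE !negb_or.
  by rewrite ![_ == c]eq_sym => /andP[-> _] /andP[-> ->].
by rewrite ![_ == d]eq_sym => /andP[_ ->] _ /andP[-> ->].
Qed.

Lemma pairing_not_staller_wins k S D L : uniq L ->
  (forall v, covered S D L v) -> ~~ staller_wins_within k S D.
Proof.
elim: k S D => [|k IHk] S D uL cov.
  by rewrite /= orbF; apply: not_staller_won => v; apply: covered_not_won.
apply/negP => /staller_wins_withinS_inv[|[x [xS xD winD winy]]].
  by apply/negP/not_staller_won => v; apply: covered_not_won.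
have [D' [D'E cov']] := covered_reply uL xS xD.
have /negP[] := IHk (x |: S) D' uL (fun v => cov' v (cov v)).
by case: D'E => [->|[y [yx _ yS yD ->]]] //; apply: winy.
Qed.

Definition nbh_pair L v : Prop :=
  exists a b, [/\ (a, b) \in pairs L, a \in closed_nbh v & b \in closed_nbh v].

Lemma nbh_pair_cat L1 L2 v : ~~ odd (size L1) ->
  nbh_pair L1 v \/ nbh_pair L2 v -> nbh_pair (L1 ++ L2) v.
Proof.
move=> e1; rewrite /nbh_pair pairs_cat //.
by case=> -[a [b [ab av bv]]]; exists a, b; rewrite mem_cat ab ?orbT.
Qed.

(** A vertex and its partner are adjacent, so both lie in its closed neighborhood. Only the last
    vertex of a path of odd order has no partner. *)
Lemma path_pairs x p v : path (@adj G) x p -> v \in x :: p ->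
  odd (size p) || (v != last x p) ->
  nbh_pair (x :: p) v.
Proof.
have [m] := ubnP (size p); elim: m x p => // m IHm x [|a p] /=.
  by rewrite mem_seq1 => _ _ ->.
move=> sm /andP[xa pa]; rewrite !inE => vxp cond.
case: (boolP ((v == x) || (v == a))) => [vxa|].
  exists x, a; rewrite inE eqxx; split=> //.
    by case/orP: vxa => /eqP->; rewrite ?closed_nbh_refl ?adj_closed_nbh_sym.
  by case/orP: vxa => /eqP->; rewrite ?closed_nbh_refl ?adj_closed_nbh.
rewrite negb_or => /andP[/negbTE vx /negbTE va]; rewrite vx va /= in vxp.
case: p sm pa vxp cond => //= b p sm /andP[_ pb] vp; rewrite negbK => cond.
have [|c [d [cd cv dv]]] := IHm b p _ pb vp cond; first by rewrite -ltnS ltnW.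
by exists c, d; split=> //; rewrite inE cd orbT.
Qed.

Lemma even_path_pairs x p v : path (@adj G) x p -> ~~ odd (size p) -> v \in p ->
  nbh_pair p v.
Proof.
case: p => //= y p /andP[_ py]; rewrite negbK => op vp.
by apply: path_pairs py vp _; rewrite op.
Qed.

(** For Dominator holding the end of a path of either parity: the end dominates itself and its
    predecessor, the only other vertex that may lack a partner. *)
Lemma belast_path_pairs x p v : path (@adj G) x p -> v \in x :: p ->
  last x p \in closed_nbh v \/ nbh_pair (belast x p) v.
Proof.
case/lastP: p => [|p d] /=; first by rewrite mem_seq1 => _ /eqP->; left; apply: closed_nbh_refl.
rewrite rcons_path belast_rcons last_rcons -rcons_cons mem_rcons inE.
case/andP=> xp pd /orP[/eqP->|vp]; first by left; apply: closed_nbh_refl.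
case: (eqVneq v (last x p)) => [->|vl]; first by left; apply: adj_closed_nbh.
by right; apply: path_pairs; rewrite ?vl ?orbT.
Qed.

(* The star with center [x] and legs [p1], [p2], [p3] is the only part of the
   board where Staller can still hope to win: the closed neighborhood of every
   other vertex is met by [D] or contains a free pair of consecutive elements
   (of ranks 2i and 2i+1) of [L]. *)
Record live_star S D L x p1 p2 p3 : Prop := LiveStar {
  live_uniq : uniq (L ++ x :: p1 ++ p2 ++ p3);
  live_even : ~~ odd (size L);
  live_evens : [/\ ~~ odd (size p1), ~~ odd (size p2) & ~~ odd (size p3)];
  live_free : forall v, v \in x :: p1 ++ p2 ++ p3 -> v \notin S :|: D;
  live_path : [/\ path (@adj G) x p1, path (@adj G) x p2 & path (@adj G) x p3];
  live_cov : forall v, v \notin x :: p1 ++ p2 ++ p3 -> covered S D L v }.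

Lemma live_star12 S D L x p1 p2 p3 :
  live_star S D L x p1 p2 p3 -> live_star S D L x p2 p1 p3.
Proof.
case=> u eL [e1 e2 e3] fr [a1 a2 a3] cv.
have E : x :: p2 ++ p1 ++ p3 =i x :: p1 ++ p2 ++ p3.
  by move=> v; rewrite !inE !mem_cat; congr (_ || _); rewrite orbCA.
split=> // [|v|v]; rewrite ?E; [|exact: fr|exact: cv].
by move: u; congr is_true; apply: perm_uniq; rewrite perm_cat2l perm_cons perm_catCA.
Qed.

Lemma live_star13 S D L x p1 p2 p3 :
  live_star S D L x p1 p2 p3 -> live_star S D L x p3 p2 p1.
Proof.
case=> u eL [e1 e2 e3] fr [a1 a2 a3] cv.
have E : x :: p3 ++ p2 ++ p1 =i x :: p1 ++ p2 ++ p3.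
  by move=> v; rewrite !inE !mem_cat; case: (_ == _) (v \in p1) (v \in p2) (v \in p3) => [] [] [] [].
split=> // [|v|v]; rewrite ?E; [|exact: fr|exact: cv].
move: u; congr is_true; apply: perm_uniq; rewrite perm_cat2l perm_cons.
by rewrite perm_catC catA perm_cat2r perm_catC.
Qed.

(* Staller claims [s] and Dominator answers [d]; [V] is the part of the star
   that stays live and [Q] lists the new pairs. *)
Lemma live_step S D L x p1 p2 p3 s d Q V : live_star S D L x p1 p2 p3 ->
  (forall z, count_mem z (s :: d :: Q ++ V) <= count_mem z (x :: p1 ++ p2 ++ p3)) ->
  (forall v, v \in x :: p1 ++ p2 ++ p3 -> v \notin V -> 
     d \in closed_nbh v \/ nbh_pair Q v) ->
  [/\ uniq ((L ++ Q) ++ V), [/\ d != s, d \notin S & d \notin D],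
      forall v, v \in V -> v \notin (s |: S) :|: (d |: D) &
      forall v, v \notin V -> covered (s |: S) (d |: D) (L ++ Q) v].
Proof.
move=> lv; have := live_cov lv; have := live_free lv; have := live_uniq lv.
(* The star has no repetitions, so the bound on counts makes [s], [d], [Q] and [V] disjoint parts of
   it, and all of them are disjoint from [L]. *)
have eL := live_even lv; move: {lv} (x :: _) => U uLU fr cov le cU.
have cnt z : count_mem z L + count_mem z U <= 1.
  by rewrite -count_cat count_uniq_mem //; case: (_ \in _).
have inU z : z \in s :: d :: Q ++ V -> z \in U.
  by rewrite !mem_count => /leq_trans; apply; apply: le.
have sep z : z \in Q ++ V -> (z != s) && (z != d).
  move=> zQV; have : 0 < count_mem z (Q ++ V) by rewrite -mem_count.
  have := cnt z; have := le z; rewrite /= ![_ == z]eq_sym.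
  by case: (z == s); case: (z == d) => //=; lia.
have frQ z : z \in Q ++ V -> z \notin (s |: S) :|: (d |: D).
  move=> zQV; have /fr : z \in U by apply: inU; rewrite !inE zQV !orbT.
  by have := sep _ zQV; rewrite !inE !negb_or => /andP[-> ->].
have dU : d \in U by apply: inU; rewrite !inE eqxx orbT.
have sU : s \in U by apply: inU; rewrite !inE eqxx.
have ds : d != s.
  by have := cnt s; have := le s; rewrite /= eqxx; case: (d == s) => //=; lia.
have [dS dD] : d \notin S /\ d \notin D.
  by have := fr _ dU; rewrite inE negb_or => /andP.
have [sS sD] : s \notin S /\ s \notin D.
  by have := fr _ sU; rewrite inE negb_or => /andP.
have LU z : z \in L -> z \notin U by rewrite !mem_count => zL; have := cnt z; move: zL; clear; lia.
split=> // [|v vV|v vV].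
- apply: count_mem_uniq => z; rewrite mem_count.
  by have := cnt z; have := le z; rewrite /= !count_cat; clear; lia.
- by apply: frQ; rewrite mem_cat vV orbT.
have hit : d \in closed_nbh v -> covered (s |: S) (d |: D) (L ++ Q) v.
  by move=> dv; left; exists d; split; rewrite ?setU11 // !inE negb_or ds.
case: (boolP (v \in U)) => vU.
  case: (cU _ vU vV) => [/hit //|[a [b [ab av bv]]]].
  have [aQ bQ] := mem_pairs ab.
  right; exists a, b; split=> //; first by rewrite pairs_cat // mem_cat ab orbT.
    by apply: frQ; rewrite mem_cat aQ.
  by apply: frQ; rewrite mem_cat bQ.
case: (cov _ vU) => [[e [ev eD eS]]|[a [b [ab av bv aF bF]]]].
  left; exists e; split=> //; first by rewrite !inE eD orbT.
  by rewrite !inE negb_or eS andbT; apply: contraNneq sD => <-.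
have [aL bL] := mem_pairs ab.
right; exists a, b; split=> //; first by rewrite pairs_cat // mem_cat ab.
  move: aF; rewrite !inE !negb_or => /andP[-> ->]; rewrite !andbT.
  by apply/andP; split; apply: contraNneq (LU _ aL) => ->.
move: bF; rewrite !inE !negb_or => /andP[-> ->]; rewrite !andbT.
by apply/andP; split; apply: contraNneq (LU _ bL) => ->.
Qed.

Lemma live_star_not_won S D L x p1 p2 p3 :
  live_star S D L x p1 p2 p3 -> ~~ staller_won S.
Proof.
move=> lv; apply: not_staller_won => v.
case: (boolP (v \in x :: p1 ++ p2 ++ p3)) => [/(live_free lv)|/(live_cov lv)].
  by rewrite inE negb_or => /andP[vS _]; exists v; rewrite ?closed_nbh_refl.
exact: covered_not_won.
Qed.

(** Induction on the moves left, with Dominator's reply chosen by the position of Staller's vertex.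
    The guard [m = k.+1] lets the induction hypothesis apply when no move remains. *)
Lemma live_star_lower m S D L x p1 p2 p3 : live_star S D L x p1 p2 p3 ->
  (forall k, m = k.+1 ->
     ~~ pow2_cover k (size p1)./2 (size p2)./2 (size p3)./2) ->
  ~~ staller_wins_within m S D.
Proof.
elim: m S D L x p1 p2 p3 => [|m IHm] S D L x p1 p2 p3 lv ncov.
  by rewrite /= orbF; apply: live_star_not_won lv.
apply/negP => /staller_wins_withinS_inv[|[s [sS sD winD winy]]].
  exact/negP/live_star_not_won/lv.
have {}ncov := ncov m erefl.
(* When Staller takes the center and a leg [d :: e :: q1] exists, Dominator takes [d]: it dominates
   the center, itself and [e], and the even rests of the legs are paired. *)
have center q1 q2 q3 : live_star S D L x q1 q2 q3 -> s = x -> q1 = [::].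
  case: q1 => [|d [|e q1]] // lv' Es; first by case: (live_evens lv').
  have [_ e2 e3] := live_evens lv'.
  have [+ a2 a3] := live_path lv'; move=> /= /and3P[xd de eq1].
  have [+ _ _] := live_evens lv'; rewrite /= negbK => e1.
  have [|v vU _|uQ [ds dS dD] _ cov] :=
      @live_step _ _ _ _ _ _ _ s d (q2 ++ q3 ++ q1) [::] lv' _ _.
  - by move=> z; rewrite Es /= !count_cat /=; clear; lia.
  - have := vU; rewrite !in_cons !mem_cat => /or3P[/eqP->|/eqP->|].
    + by left; apply: adj_closed_nbh.
    + by left; apply: closed_nbh_refl.
    case/orP=> [/eqP->|]; first by left; apply: adj_closed_nbh_sym.
    case/or3P=> vq; right.
    + do 2![apply: nbh_pair_cat => //; right].
      exact: even_path_pairs eq1 e1 vq.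
    + by apply: nbh_pair_cat => //; left; apply: even_path_pairs a2 e2 vq.
    apply: nbh_pair_cat => //; right; apply: nbh_pair_cat => //; left.
    exact: even_path_pairs a3 e3 vq.
  rewrite cats0 in uQ.
  have /negP[] := pairing_not_staller_wins m uQ (fun v => cov v isT).
  exact: winy.
have leg q1 q2 q3 : live_star S D L x q1 q2 q3 ->
    ~~ pow2_cover m (size q1)./2 (size q2)./2 (size q3)./2 -> s \notin q1.
  move=> lv' nc; apply/negP => sq1; case/splitPr: sq1 lv' nc => q r lv' nc.
  have [+ a2 a3] := live_path lv'; rewrite cat_path /= => /and3P[aq qs sr].
  have [+ e2 e3] := live_evens lv'; rewrite size_cat /= addnS /= negbK => e1.
  have inU v : v \in x :: (q ++ s :: r) ++ q2 ++ q3 ->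
      [\/ v \in x :: q, v = s, v \in r | v \in q2 \/ v \in q3].
    rewrite !(inE, mem_cat) -!orbA; case/or4P=> [->|->|/eqP->|].
    - by constructor 1.
    - by constructor 1; rewrite orbT.
    - by constructor 2.
    by case/or3P=> vP; [constructor 3|constructor 4; left|constructor 4; right].
  (* Dominator spoils the part of the star that contains the center. *)
  have keep_r e r' : r = e :: r' -> ~~ odd (size q) ->
      (forall k, m = k.+1 -> ~~ pow2_cover k (size r')./2 0 0) -> False.
    move=> Er eq nck; rewrite {}Er in lv' nc sr e1 inU.
    have [|v /inU vU vV|uQ [ds dS dD] frV cov] :=
        @live_step _ _ _ _ _ _ _ s (last x q) (q2 ++ q3 ++ belast x q)
          (e :: r' ++ [::] ++ [::]) lv' _ _.
    + move=> z; have := lastI x q => /(congr1 (count_mem z)).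
      by rewrite !cats0 -cats1 !count_cat /= !count_cat /=; clear; lia.
    + case: vU vV => [vq|->|vr|[vq|vq]].
      * case: (belast_path_pairs aq vq) => [|P]; [by left|right].
        by do 2![apply: nbh_pair_cat => //; right].
      * by left; apply: adj_closed_nbh_sym.
      * by rewrite !cats0 vr.
      * by right; apply: nbh_pair_cat => //; left; apply: even_path_pairs a2 e2 vq.
      right; apply: nbh_pair_cat => //; right; apply: nbh_pair_cat => //; left.
      exact: even_path_pairs a3 e3 vq.
    have /negP[] : ~~ staller_wins_within m (s |: S) (last x q |: D).
      apply: (IHm _ _ (L ++ q2 ++ q3 ++ belast x q) e r' [::] [::]) => //.
      split=> //; last by move: sr => /= /andP[].
        by rewrite !size_cat size_belast !oddD (negbTE (live_even lv')) (negbTE e2) (negbTE e3).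
      by split=> //; move: e1 eq; rewrite /=; clear; lia.
    exact: winy.
  (* Dominator spoils the path that was cut off. *)
  have keep_q d r' : r = d :: r' -> ~~ odd (size q) ->
      (forall k, m = k.+1 ->
         ~~ pow2_cover k (size q)./2 (size q2)./2 (size q3)./2) -> False.
    move=> Er eq nck; rewrite {}Er in lv' nc sr e1 inU.
    have er : ~~ odd (size r') by move: e1 eq; rewrite /=; clear; lia.
    move: sr => /= /andP[sd dr].
    have [|v /inU vU vV|uQ [ds dS dD] frV cov] :=
        @live_step _ _ _ _ _ _ _ s d r' (x :: q ++ q2 ++ q3) lv' _ _.
    + by move=> z; rewrite /= !count_cat /= !count_cat /=; clear; lia.
    + case: vU vV => [vq|->|vr|[vq|vq]]; rewrite -?cat_cons ?mem_cat ?vq ?orbT //.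
      * by left; apply: adj_closed_nbh.
      move: vr; rewrite in_cons => /orP[/eqP->|vr] _; first by left; apply: closed_nbh_refl.
      by right; apply: even_path_pairs dr er vr.
    have /negP[] : ~~ staller_wins_within m (s |: S) (d |: D).
      apply: (IHm _ _ (L ++ r') x q q2 q3) => //.
      by split=> //; rewrite size_cat oddD (negbTE (live_even lv')).
    exact: winy.
  (* For [q] odd, [r] is even and pairs itself; the neighbor of [s] towards the center then protects
     the other part, and no live star remains. *)
  case: (boolP (odd (size q))) => oq.
    have er : ~~ odd (size r) by move: e1; rewrite oddD oq; case: odd.
    have [|v /inU vU vV|uQ [ds dS dD] frV cov] :=
        @live_step _ _ _ _ _ _ _ s (last x q) (q2 ++ q3 ++ r ++ belast x q)
          [::] lv' _ _.
    + move=> z; have := lastI x q => /(congr1 (count_mem z)).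
      by rewrite -cats1 !count_cat /= !count_cat /=; clear; lia.
    + case: vU => [vq|->|vr|[vq|vq]].
      * case: (belast_path_pairs aq vq) => [|P]; [by left|right].
        by do 3![apply: nbh_pair_cat => //; right].
      * by left; apply: adj_closed_nbh_sym.
      * right; do 2![apply: nbh_pair_cat => //; right]; apply: nbh_pair_cat => //; left.
        exact: even_path_pairs sr er vr.
      * by right; apply: nbh_pair_cat => //; left; apply: even_path_pairs a2 e2 vq.
      right; apply: nbh_pair_cat => //; right; apply: nbh_pair_cat => //; left.
      exact: even_path_pairs a3 e3 vq.
    rewrite cats0 in uQ.
    have /negP[] := pairing_not_staller_wins m uQ (fun v => cov v isT).
    exact: winy.
  case Er: r e1 => [|e r'] /=; first by rewrite addn0 (negbTE oq).
  rewrite addnS /= oddD (negbTE oq) /= => er.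
  case: m nc {IHm winD winy ncov center} keep_q keep_r => [|k] nc kq kr.
    by apply: kq Er oq _.
  (* The cut-off path has [2t - 1] vertices. If [t <= 2 ^ k], a cover of the shortened star together
     with [2 ^ k] on this leg would cover the old one. Otherwise the half length [t - 1] of [r']
     exceeds the sum [2 ^ k - 1] of the remaining powers. *)
  set t := (size r')./2.+1.
  have Et : (size (q ++ s :: r))./2 = (size q)./2 + t.
    by rewrite size_cat Er /= /t !addnS /= halfD (negbTE oq).
  case: (leqP t (2 ^ k)) => tk.
    apply: (kq _ _ Er oq) => _ [<-]; apply: contra nc => cq; rewrite Et.
    by apply/or3P; constructor 1; apply: pow2_cover_mono cq => //; lia.
  apply: (kr _ _ Er oq) => _ [<-]; apply/negP => /pow2_cover_sum.
  by rewrite /t in tk; lia.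
case: (boolP (s \in x :: p1 ++ p2 ++ p3)) => sU.
  have ncov2 := ncov; rewrite pow2_cover12 in ncov2.
  have ncov3 := ncov; rewrite pow2_cover13 in ncov3.
  have lv2 := live_star12 lv; have lv3 := live_star13 lv.
  move: sU; rewrite inE !mem_cat (negbTE (leg _ _ _ lv ncov)).
  rewrite (negbTE (leg _ _ _ lv2 ncov2)) (negbTE (leg _ _ _ lv3 ncov3)) !orbF => /eqP Es.
  move: ncov; rewrite (center _ _ _ lv Es) (center _ _ _ lv2 Es) (center _ _ _ lv3 Es).
  by rewrite pow2_cover2 // expn_gt0.
have [uL UL] : uniq L /\ forall y, y \in L -> y \notin x :: p1 ++ p2 ++ p3.
  have := live_uniq lv; rewrite cat_uniq => /and3P[uL /hasPn dis _].
  split=> // y yL.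
  by apply/negP => /dis; rewrite /= yL.
(* Staller played off the star: the reply stays inside [L], so the star is untouched and she has
   lost a move. *)
have [D' [D'E cov']] := covered_reply uL sS sD.
have sub : forall y, y \in D' -> y \in D \/ y \in L.
  by move=> y; case: D'E => [->|[z [_ zL _ _ ->]]]; [left|rewrite !inE => /orP[/eqP->|]; auto].
have /negP[] : ~~ staller_wins_within m (s |: S) D'.
  apply: (IHm _ _ L x p1 p2 p3) => [|k mk]; last first.
    by apply: contra ncov; rewrite mk; apply: pow2_coverS.
  case: lv => u eL ev fr pth cov; split=> // v vU; last exact/cov'/cov.
  have := fr v vU; rewrite !inE !negb_or => /andP[-> vD]; rewrite andbT.
  apply/andP; split; first by apply: contraNneq sU => <-.
  by apply/negP => /sub[|/UL]; [apply/negP|rewrite vU].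
by case: D'E => [->|[y [yx _ yS yD ->]]] //; apply: winy.
Qed.

End Dominator.

(** * Staller's strategy *)

Section Staller.
Variable G : sgraph.
Implicit Types (S D : {set G}) (p q r : seq G) (v x y : G).

(** Absence of chords in the form used for cutting: claiming [s] separates the outer piece of the
    leg from the inner one and the center. *)
Definition induced_leg x p : Prop :=
  forall q s r, p = q ++ s :: r -> forall u w, u \in r -> w \in x :: q -> ~~ adj u w.

Definition anticomplete p q : Prop :=
  forall u w, u \in p -> w \in q -> ~~ adj u w.

(* The star is an unclaimed induced subgraph whose other neighbors all belong to
   Staller, so that she wins as soon as she wins the game on the star. *)
Record enclosed_star S D x p1 p2 p3 : Prop := EnclosedStar {
  encl_uniq : uniq (x :: p1 ++ p2 ++ p3);
  encl_evens : [/\ ~~ odd (size p1), ~~ odd (size p2) & ~~ odd (size p3)];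
  encl_free : forall v, v \in x :: p1 ++ p2 ++ p3 -> v \notin S :|: D;
  encl_leg : [/\ induced_leg x p1, induced_leg x p2 & induced_leg x p3];
  encl_anti : [/\ anticomplete p1 p2, anticomplete p1 p3 & anticomplete p2 p3];
  encl_nbh : forall u w, u \in x :: p1 ++ p2 ++ p3 -> adj u w ->
     w \in S \/ w \in x :: p1 ++ p2 ++ p3 }.

Lemma anticomplete_sym p q : anticomplete p q -> anticomplete q p.
Proof. by move=> H u w uq wp; rewrite adj_sym; apply: H. Qed.

Lemma enclosed_star12 S D x p1 p2 p3 :
  enclosed_star S D x p1 p2 p3 -> enclosed_star S D x p2 p1 p3.
Proof.
case=> u [e1 e2 e3] fr [l1 l2 l3] [a12 a13 a23] nb.
have P : perm_eq (x :: p2 ++ p1 ++ p3) (x :: p1 ++ p2 ++ p3).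
  by rewrite perm_cons perm_catCA.
have E := perm_mem P.
split=> // [|v|| y w]; rewrite ?(perm_uniq P) ?E //; [exact: fr| |exact: nb].
by split=> //; apply: anticomplete_sym.
Qed.

Lemma enclosed_star13 S D x p1 p2 p3 :
  enclosed_star S D x p1 p2 p3 -> enclosed_star S D x p3 p2 p1.
Proof.
case=> u [e1 e2 e3] fr [l1 l2 l3] [a12 a13 a23] nb.
have P : perm_eq (x :: p3 ++ p2 ++ p1) (x :: p1 ++ p2 ++ p3).
  by rewrite perm_cons perm_catC catA perm_cat2r perm_catC.
have E := perm_mem P.
split=> // [|v|| y w]; rewrite ?(perm_uniq P) ?E //; [exact: fr| |exact: nb].
by split=> //; apply: anticomplete_sym.
Qed.

(** Claiming [s] leaves two parts with no edge between them, and Dominator's single reply [y] misses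
    one. The outer part is a path, seen as a star with center [e] and one leg; [q] even makes [r]
    even. *)
Lemma enclosed_star_split S D x q s e r p2 p3 y :
  enclosed_star S D x (q ++ s :: e :: r) p2 p3 -> ~~ odd (size q) ->
  y \notin (s |: S) :|: D ->
  enclosed_star (s |: S) (y |: D) x q p2 p3 \/
  enclosed_star (s |: S) (y |: D) e r [::] [::].
Proof.
case=> u [e1 e2 e3] fr [l1 l2 l3] [a12 a13 a23] nb eq yF.
have er : ~~ odd (size r) by move: e1 eq; rewrite size_cat /=; clear; lia.
have cnt z : count_mem z (x :: (q ++ s :: e :: r) ++ p2 ++ p3) <= 1.
  by rewrite count_uniq_mem //; case: (_ \in _).
pose U1 := x :: q ++ p2 ++ p3; pose U2 := e :: r ++ [::] ++ [::].
have cU z : count_mem z (x :: (q ++ s :: e :: r) ++ p2 ++ p3) =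
    (z == s) + count_mem z U1 + count_mem z U2.
  by rewrite /U1 /U2 !cats0 /= !count_cat /= [z == s]eq_sym; clear; lia.
have u1 : uniq U1.
  by apply: count_mem_uniq => z; rewrite mem_count; move: (cnt z); rewrite cU; clear; lia.
have u2 : uniq U2.
  by apply: count_mem_uniq => z; rewrite mem_count; move: (cnt z); rewrite cU; clear; lia.
have memU z : (z \in x :: (q ++ s :: e :: r) ++ p2 ++ p3) = [|| z == s, z \in U1 | z \in U2].
  by rewrite !mem_count cU; clear; lia.
have s1 : s \notin U1.
  by rewrite mem_count; move: (cnt s); rewrite cU eqxx; clear; lia.
have s2 : s \notin U2.
  by rewrite mem_count; move: (cnt s); rewrite cU eqxx; clear; lia.
have dis z : z \in U1 -> z \notin U2.
  by rewrite !mem_count; move: (cnt z); rewrite cU; clear; lia.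
have no_edge a b : a \in U2 -> b \in U1 -> ~~ adj a b.
  rewrite /U1 /U2 !cats0 -cat_cons !mem_cat => a2 /or3P[bq|b2|b3].
  - exact: (l1 q s (e :: r)).
  - by apply: a12 => //; rewrite mem_cat inE a2 !orbT.
  - by apply: a13 => //; rewrite mem_cat inE a2 !orbT.
have free V : {subset V <= x :: (q ++ s :: e :: r) ++ p2 ++ p3} ->
    s \notin V -> y \notin V ->
    forall v, v \in V -> v \notin (s |: S) :|: (y |: D).
  move=> sub sV yV v vV; have := fr v (sub v vV).
  rewrite !inE !negb_or => /andP[-> ->]; rewrite !andbT.
  by apply/andP; split; [apply: contraNneq sV => <-|apply: contraNneq yV => <-].
(* [U1] is the part with the center and [U2] the outer path; the part avoiding [y] is kept. *)
case: (boolP (y \in U1)) => y1; [right|left].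
  split=> //.
  - by apply: free => //; [move=> z zV; rewrite memU zV !orbT|apply: dis].
  - split; [|by case|by case] => q1 s1' r1 E a b ar bq.
    apply: (l1 (q ++ s :: e :: q1) s1' r1) => //; first by rewrite E -catA.
    by rewrite inE mem_cat !in_cons; move: bq; rewrite inE => ->; rewrite !orbT.
  - move=> a b a2 ab; case: (nb a b _ ab) => [|bS|]; first by rewrite memU a2 !orbT.
      by left; rewrite !inE bS orbT.
    rewrite memU => /or3P[/eqP->|b1|]; [by left; rewrite setU11| |by right].
    by move/negP: (no_edge a b a2 b1); case.
split=> //.
- by apply: free => // z zV; rewrite memU zV !orbT.
- split=> // q1 s1' r1 E a b ar bq.
  apply: (l1 q1 s1' (r1 ++ s :: e :: r)) => //; first by rewrite E -catA.
  by rewrite mem_cat ar.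
- by split=> // a b aq bp; [apply: a12|apply: a13]; rewrite ?mem_cat ?aq.
- move=> a b a1 ab; case: (nb a b _ ab) => [|bS|]; first by rewrite memU a1 !orbT.
    by left; rewrite !inE bS orbT.
  rewrite memU => /or3P[/eqP->|b1|b2]; [by left; rewrite setU11|by right|].
  by move/negP: (no_edge b a b2 a1); rewrite adj_sym; case.
Qed.

(** Staller cuts the leg to which the cover assigns the top power [2 ^ k]; both resulting parts are
    covered by the remaining powers. With no power left the star is one vertex, and taking it
    completes its closed neighborhood. *)
Lemma enclosed_star_upper k S D x p1 p2 p3 : enclosed_star S D x p1 p2 p3 ->
  pow2_cover k (size p1)./2 (size p2)./2 (size p3)./2 ->
  staller_wins_within k.+1 S D.
Proof.
elim: k S D x p1 p2 p3 => [|k IHk] S D x p1 p2 p3 st cov.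
  have [e1 e2 e3] := encl_evens st; move: cov => /= /and3P[z1 z2 z3].
  have nil p : ~~ odd (size p) -> (size p)./2 == 0 -> p = [::].
    by case: p => [|a [|b p]].
  rewrite (nil p1) // (nil p2) // (nil p3) // {p1 p2 p3 e1 e2 e3 z1 z2 z3} in st.
  apply/orP; right; apply/existsP; exists x.
  rewrite (encl_free st) ?mem_head //=; apply/orP; left.
  apply/existsP; exists x; apply/subsetP => w; rewrite inE => /orP[/eqP->|xw].
    exact: setU11.
  by case: (encl_nbh st (mem_head _ _) xw) => wS; rewrite !inE in wS *; rewrite wS ?orbT.
have step q1 q2 q3 : enclosed_star S D x q1 q2 q3 ->
    pow2_cover k ((size q1)./2 - 2 ^ k) (size q2)./2 (size q3)./2 ->
    staller_wins_within k.+2 S D.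
  move=> {p1 p2 p3 cov} st cov; have [e1 _ _] := encl_evens st.
  case: (posnP (size q1)./2) => [z1|pos1].
    by apply/staller_wins_withinS/(IHk _ _ _ _ _ _ st); rewrite z1 in cov *.
  (* Cutting off [2t - 1] vertices leaves the half length [a - t = a - 2 ^ k] on the leg, while the
     outer star has a leg of half length [t - 1 < 2 ^ k]. *)
  set a := (size q1)./2 in cov pos1 *; pose t := minn a (2 ^ k).
  have pos : 0 < 2 ^ k by rewrite expn_gt0.
  have ea : size q1 = a.*2 by rewrite -[LHS]odd_double_half (negbTE e1).
  have sq : size (take (a - t).*2 q1) = (a - t).*2.
    by rewrite size_take ea; case: ltnP => //; rewrite /t; clear - pos; lia.
  have sr : size (drop (a - t).*2 q1) = t.*2.
    by rewrite size_drop ea /t; clear - pos; lia.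
  have Eq1 := cat_take_drop (a - t).*2 q1.
  case Ed : (drop _ q1) Eq1 sr => [|s [|e r]] Eq1 /= sr.
  1,2: by move: sr pos1 pos; rewrite /t; clear; lia.
  set q := take _ q1 in sq Eq1; rewrite -{}Eq1 in st.
  have sF : s \notin S :|: D.
    by apply: (encl_free st); rewrite !(inE, mem_cat) eqxx ?orbT.
  have eF : e \notin S :|: D.
    by apply: (encl_free st); rewrite !(inE, mem_cat) eqxx ?orbT.
  have es : e != s.
    apply/eqP => E; have := encl_uniq st; rewrite E /= => /andP[_].
    by rewrite !cat_uniq /= inE eqxx /= !andbF.
  apply/orP; right; apply/existsP; exists s; rewrite sF /=; apply/orP; right.
  apply/andP; split.
    by apply/existsP; exists e; rewrite /= -setUA in_setU1 negb_or es.
  apply/forallP => y; apply/implyP => yF.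
  have oq : ~~ odd (size q) by rewrite sq odd_double.
  have [st'|st'] := enclosed_star_split st oq yF; apply: (IHk _ _ _ _ _ _ st').
    by apply: pow2_cover_mono cov; rewrite // sq doubleK /t; clear; lia.
  apply: pow2_cover2; move: sr; rewrite addn0 /t; move: pos; clear; lia.
move: cov; rewrite pow2_coverSE => /or3P[].
- exact: step.
- by rewrite pow2_cover12; apply/step/enclosed_star12.
- by rewrite pow2_cover13; apply/step/enclosed_star13.
Qed.

End Staller.

(** * Legs of the concrete subdivided star, listed outwards from the center *)

Section StarLegs.
Variable ns : seq nat.
Local Notation T := (subdivided_star ns).
Implicit Types (i : 'I_(size ns)) (u v : T).

Definition star_leg i : seq T :=
  [seq Some (Tagged (fun i : 'I_(size ns) => 'I_(nth 0 ns i)) j) | j <- enum 'I_(nth 0 ns i)].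

Definition star_depth (v : T) : nat := if v is Some a then (tagged a).+1 else 0.

Lemma size_star_leg i : size (star_leg i) = nth 0 ns i.
Proof. by rewrite size_map size_enum_ord. Qed.

Lemma mem_star_leg i (v : T) : (v \in star_leg i) = (if v is Some a then tag a == i else false).
Proof.
apply/mapP/idP => [[j _ ->] /=|]; first exact: eqxx.
case: v => [[i' j] /= /eqP E|//]; move: E j => -> j.
by exists j; rewrite ?mem_enum.
Qed.

Lemma star_leg_uniq i : uniq (star_leg i).
Proof.
rewrite map_inj_uniq ?enum_uniq // => j j' /Some_inj/eqP.
by rewrite eq_Tagged => /eqP.
Qed.

Lemma nth_star_leg i j (ji : j < nth 0 ns i) :
  nth (None : T) (star_leg i) j =
    Some (Tagged (fun i : 'I_(size ns) => 'I_(nth 0 ns i)) (Ordinal ji)).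
Proof.
rewrite (nth_map (Ordinal ji)) ?size_enum_ord //.
by rewrite -[j in nth _ _ j]/(val (Ordinal ji)) nth_ord_enum.
Qed.

Lemma star_depth_leg i : map star_depth (None :: star_leg i) = iota 0 (nth 0 ns i).+1.
Proof.
rewrite /= -map_comp -[1]addn0 iotaDl -val_enum_ord -map_comp.
by congr cons; apply: eq_map.
Qed.

Lemma star_adj_depth u v : adj u v ->
  (star_depth u == (star_depth v).+1) || (star_depth v == (star_depth u).+1).
Proof.
case: u v => [a|] [b|] //=; rewrite ?eqSS //; last by rewrite orbF.
by case/andP=> _ /orP[] /eqP <-; rewrite eqxx ?orbT.
Qed.

(** Depth increases strictly along a leg, so vertices on opposite sides of [s] differ in depth by at
    least two, whereas adjacent ones differ by one. *)
Lemma induced_star_leg i : induced_leg (None : T) (star_leg i).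
Proof.
move=> q s r E u w ur wq; apply/negP => /star_adj_depth.
have : sorted ltn (map star_depth (None :: star_leg i)).
  by rewrite star_depth_leg iota_ltn_sorted.
rewrite (sorted_pairwise ltn_trans) E -cat_cons map_cat pairwise_cat.
case/and3P=> /allrelP H1 _ /=; case/andP=> /allP H2 _.
have ws := H1 _ _ (map_f star_depth wq) (mem_head _ _).
have su := H2 _ (map_f star_depth ur).
by move: (leq_ltn_trans ws su); clear; lia.
Qed.

Lemma path_star_leg i : path (@adj T) (None : T) (star_leg i).
Proof.
apply/(pathP (None : T)) => j; rewrite size_star_leg => ji.
case: j ji => [|j] ji; rewrite nth_star_leg //=.
by rewrite (nth_star_leg (ltnW ji)) /= !eqxx.
Qed.

Lemma anticomplete_star_leg i i' : i != i' -> anticomplete (star_leg i) (star_leg i').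
Proof.
move=> ii' u w; rewrite !mem_star_leg; case: u w => [a|] [b|] //= /eqP Ea /eqP Eb.
by apply: contra ii' => /andP[/eqP E _]; rewrite -Ea -Eb E.
Qed.

End StarLegs.

(** * Exact winning criterion on stars with three even legs *)

Section TriStar.
Variables n1 n2 n3 : nat.
Local Notation T := (subdivided_star [:: n1; n2; n3]).
Local Notation leg j := (@star_leg [:: n1; n2; n3] (@Ordinal 3 j isT)).

Lemma tristar_vertices (v : T) : v \in None :: leg 0 ++ leg 1 ++ leg 2.
Proof.
case: v => [[i j]|] //; rewrite in_cons !mem_cat !mem_star_leg /= -!val_eqE /=.
by case: i j => -[|[|[|]]].
Qed.

Lemma tristar_uniq : uniq (None :: leg 0 ++ leg 1 ++ leg 2).
Proof.
rewrite cons_uniq; apply/andP; split; first by rewrite !mem_cat !mem_star_leg.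
rewrite !cat_uniq !star_leg_uniq !andbT !andTb.
by apply/andP; split; apply/hasPn => -[[i j]|];
  rewrite ?mem_cat ?mem_star_leg /= ?mem_star_leg // -?val_eqE;
  case: i j => -[|[|[|]]].
Qed.

(** Initially the star is the whole board: it is live with the empty pairing, and enclosed because
    no neighbor lies outside. *)
Lemma staller_wins_tristar k : ~~ odd n1 -> ~~ odd n2 -> ~~ odd n3 ->
  staller_wins_within k.+1 (set0 : {set T}) set0 = pow2_cover k n1./2 n2./2 n3./2.
Proof.
move=> even1 even2 even3.
have ev : [/\ ~~ odd (size (leg 0)), ~~ odd (size (leg 1)) & ~~ odd (size (leg 2))].
  by rewrite !size_star_leg.
have free v : v \in None :: leg 0 ++ leg 1 ++ leg 2 -> v \notin (set0 : {set T}) :|: set0.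
  by rewrite !inE.
apply/idP/idP => [|cov].
  apply: contraTT => cov.
  apply: (@live_star_lower T k.+1 set0 set0 [::] None (leg 0) (leg 1) (leg 2)).
    split=> //; first exact: tristar_uniq.
    - by split; apply: path_star_leg.
    - by move=> v; rewrite tristar_vertices.
  by move=> _ [<-]; rewrite !size_star_leg.
apply: (@enclosed_star_upper T k set0 set0 None (leg 0) (leg 1) (leg 2)).
  split=> //; first exact: tristar_uniq.
  - by split; apply: induced_star_leg.
  - by split; apply: anticomplete_star_leg.
  - by move=> u w _ _; right; apply: tristar_vertices.
by rewrite !size_star_leg.
Qed.

End TriStar.

Theorem theorem20 (n1 n2 n3 : nat)
  (pos1 : 0 < n1) (pos2 : 0 < n2) (pos3 : 0 < n3)
  (even1 : ~~ odd n1) (even2 : ~~ odd n2) (even3 : ~~ odd n3)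
  (le12 : n1 <= n2) (le23 : n2 <= n3) :
  (class_T0 [:: n1; n2; n3] ->
     gamma_SMB' (subdivided_star [:: n1; n2; n3])
     = Some (up_log 2 (n1 + n2 + n3 + 1))) /\
  (class_T1 [:: n1; n2; n3] ->
     gamma_SMB' (subdivided_star [:: n1; n2; n3])
     = Some (up_log 2 (n1 + n2 + n3 + 1) + 1)).
Proof.
have T : even_tristar n1 n2 n3 by [].
have [K [EK geK ltK]] := even_tristar_order T.
have := class_T1P T; rewrite EK -[K.+3.-1]/K.+2 => T1P.
have lower j k : ~~ pow2_cover k n1./2 n2./2 n3./2 ->
    staller_wins_within j (set0 : {set subdivided_star [:: n1; n2; n3]}) set0 -> k.+1 < j.
  move=> nc; apply: contraTT; rewrite -leqNgt => jk.
  by apply: contra nc => /(staller_wins_within_le jk); rewrite staller_wins_tristar.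
split=> [c0|/T1P c1]; apply/gamma_SMB'P; split.
(* Winning within [K.+3] moves amounts to a cover by [K.+2] powers, which is what the classes
   decide. *)
- rewrite staller_wins_tristar //; apply/negPn/negP => /T1P c1.
  exact: class_T0_not_T1 c0 c1.
(* The half lengths sum to at least [2 ^ K.+1], too much for [K.+1] powers, so [K.+2] moves never
   suffice. *)
- move=> j; apply: lower; apply/negP => /pow2_cover_sum; move: geK; clear; lia.
(* Since the sum is below [2 ^ K.+2], one further power always suffices. *)
- by rewrite addn1 staller_wins_tristar // pow2_coverS_sum.
by move=> j; rewrite addn1; apply: lower.
Qed.
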